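(* Let $M\in\mathbb{N}_0$ and let $u:\mathbb{Z}^d\to\mathbb{R}$ be a non-zero harmonic function. Suppose $u$ has degree $M$-polynomial growth, i.e. $\limsup_{|x|\to\infty}|u(x)|/|x|^M<\infty$. Then $u$ must be a polynomial of degree at most $M$. In particular, the space of harmonic functions on $\mathbb{Z}^d$ of degree $M$-polynomial growth is finite dimensional. Moreover, the function $u$ cannot vanish identically on a ball of radius $M$; that is, for every $x_0\in\mathbb{Z}^d$, $u$ does not vanish identically on $\{x\in\mathbb{Z}^d:|x-x_0|_1\le M\}$.
   Context: A function $u:\mathbb{Z}^d\to\mathbb{R}$ is harmonic if $\Delta u\equiv0$, where $(\Delta u)(x)=\frac{1}{2d}\sum_{y\sim x}(u(y)-u(x))$ and $y\sim x$ means that $x$ and $y$ are nearest neighbours in $\mathbb{Z}^d$. A polynomial on $\mathbb{Z}^d$ is the restriction to $\mathbb{Z}^d$ of a real polynomial in $d$ variables. For $x\in\mathbb{Z}^d$, $|x|_1$ is the graph distance from $0$ to $x$ in $\mathbb{Z}^d$; $|x|$ in the growth condition may be any fixed norm. Balls are closed balls in the graph metric, with arbitrary center in $\mathbb{Z}^d$. $\mathbb{N}_0$ denotes the non-negative integers. *)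

(* Defs.v *)
From HB Require Import structures.
From mathcomp Require Import all_boot all_order all_algebra.
From mathcomp Require Import zify.
From mathcomp Require Import (canonicals, coercions) mpoly.
From mathcomp Require Import boolp classical_sets functions reals ereal filter.

Set Implicit Arguments.
Unset Strict Implicit.
Unset Printing Implicit Defensive.

Import Order.TTheory GRing.Theory Num.Theory.
Local Open Scope classical_set_scope.
Local Open Scope ring_scope.

(* The lattice Z^d is 'rV[int]_d, with standard basis vectors
   [delta_mx 0 i]. *)

Definition nbrs (d : nat) (x : 'rV[int]_d) : seq 'rV[int]_d :=
  [seq x + delta_mx 0 i | i <- enum 'I_d] ++
  [seq x - delta_mx 0 i | i <- enum 'I_d].

Fixpoint walk (d n : nat) (x y : 'rV[int]_d) : bool :=
  if n is m.+1 then has (fun z => walk m z y) (nbrs x) else x == y.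

Lemma nbrsP (d : nat) (x y : 'rV[int]_d) :
  reflect (exists i : 'I_d, y = x + delta_mx 0 i \/ y = x - delta_mx 0 i)
          (y \in nbrs x).
Proof.
rewrite mem_cat; apply: (iffP orP) => [[]/mapP[i _ ->]|[i [->|->]]].
- by exists i; left.
- by exists i; right.
- by left; apply: map_f; rewrite mem_enum.
- by right; apply: map_f; rewrite mem_enum.
Qed.

Lemma nbrs_uniq (d : nat) (x : 'rV[int]_d) : uniq (nbrs x).
Proof.
have delta_inj (i j : 'I_d) :
    delta_mx 0 i = delta_mx 0 j :> 'rV[int]_d -> i = j.
  by move/matrixP/(_ 0 i); rewrite !mxE !eqxx /=; case: eqP.
rewrite cat_uniq; apply/and3P; split; last first.
- rewrite map_inj_uniq ?enum_uniq // => i j E.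
  by apply: delta_inj; apply: oppr_inj; apply: (addrI x).
- apply/hasPn => _ /mapP[i _ ->]; apply/mapP => -[j _ E].
  have {E} : - delta_mx 0 i = delta_mx 0 j :> 'rV[int]_d by apply: (addrI x).
  by move/matrixP/(_ 0 i); rewrite !mxE !eqxx /=; case: (i == j).
- rewrite map_inj_uniq ?enum_uniq // => i j E.
  by apply: delta_inj; apply: (addrI x).
Qed.

Lemma walk_sum (d : nat) (x y : 'rV[int]_d) :
  walk (\sum_i absz (y 0%R i - x 0%R i)) x y.
Proof.
move Ek: (\sum_i _)%N => k.
elim: k x Ek => [|k IH] x Ek.
  apply/eqP/rowP => i; move/eqP: Ek; rewrite sum_nat_eq0 => /forallP/(_ i) /=.
  by rewrite absz_eq0 subr_eq0 => /eqP.
have [i ni] : exists i, y 0 i != x 0 i.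
  apply/existsP; rewrite -[X in is_true X]negbK negb_exists.
  apply/negP => /forallP h; move: Ek; rewrite big1 // => i _.
  by have /negbNE/eqP -> := h i; rewrite subrr.
pose s : int := if (x 0 i < y 0 i)%R then 1 else -1.
have zx : x + s *: delta_mx 0 i \in nbrs x.
  apply/nbrsP; exists i; rewrite /s; case: ifP => _; [left|right].
    by rewrite scale1r.
  by rewrite scaleN1r.
apply/hasP; exists (x + s *: delta_mx 0 i) => //; apply: IH.
apply: succn_inj; rewrite -Ek (bigD1 i) //= [RHS](bigD1 i) //= -addSn.
congr (_ + _)%N.
  by rewrite !mxE !eqxx mulr1 /s; case: ltrgtP ni => // h _;
    move: (y 0 i) (x 0 i) h => a b; clear; lia.
by apply: eq_bigr => j /negPf ji; rewrite !mxE eqxx /= ji mulr0 addr0.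
Qed.

Lemma walk_connected (d : nat) (x y : 'rV[int]_d) : exists n, walk n x y.
Proof. by eexists; exact: walk_sum. Qed.

Lemma walk_ge (d n : nat) (x y : 'rV[int]_d) :
  walk n x y -> (\sum_i absz (y 0%R i - x 0%R i) <= n)%N.
Proof.
elim: n x => [|n IH] x /=.
  by move/eqP ->; rewrite big1 // => i _; rewrite subrr.
case/hasP => z /nbrsP[i zE] /IH le_n.
apply: leq_trans (_ : (\sum_j absz (y 0%R j - z 0%R j)).+1 <= _)%N => //.
rewrite (bigD1 i) //= [in X in (_ <= X)%N](bigD1 i) //= -addSn.
apply: leq_add; first by case: zE => ->; rewrite !mxE !eqxx /=; lia.
apply: leq_sum => j /negPf ji.
by case: zE => ->; rewrite !mxE eqxx /= ji ?oppr0 addr0.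
Qed.

Definition graph_dist (d : nat) (x y : 'rV[int]_d) : nat :=
  ex_minn (walk_connected x y).

Definition norm1 (d : nat) (x : 'rV[int]_d) : nat := graph_dist 0 x.

Lemma norm1E (d : nat) (x : 'rV[int]_d) :
  norm1 x = (\sum_i absz (x 0%R i))%N.
Proof.
have E : (\sum_i absz (x 0%R i - (0%R : 'rV[int]_d) 0%R i) =
          \sum_i absz (x 0%R i))%N.
  by apply: eq_bigr => i _; rewrite mxE subr0.
rewrite /norm1 /graph_dist; case: ex_minnP => n wn min_n.
by apply/eqP; rewrite eqn_leq -E walk_ge // min_n // walk_sum.
Qed.

Definition laplacian (R : realType) (d : nat) (u : 'rV[int]_d -> R)
    (x : 'rV[int]_d) : R :=
  ((2 * d)%:R)^-1 * \sum_(y <- nbrs x) (u y - u x).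

Definition harmonic (R : realType) (d : nat) (u : 'rV[int]_d -> R) : Prop :=
  forall x, laplacian u x = 0.

Record is_norm (R : realType) (d : nat) (N : 'rV[R]_d -> R) : Prop := IsNorm {
  norm_triangle : forall x y, N (x + y) <= N x + N y;
  norm_homogeneous : forall (a : R) x, N (a *: x) = `|a| * N x;
  norm_definite : forall x, N x = 0 -> x = 0
}.

Definition lattice_pt (R : realType) (d : nat) (x : 'rV[int]_d) : 'rV[R]_d :=
  map_mx intr x.

Definition norm_infty (R : realType) (d : nat) (N : 'rV[R]_d -> R) :
    set_system 'rV[int]_d :=
  filter_from setT (fun r : R => [set x | r < N (lattice_pt R x)]).

(* This is the body of [limf_esup], which itself is restricted to filtered
   types; ['rV[int]_d] is not equipped with such a structure. *)
Definition limsup_infty (R : realType) (d : nat) (N : 'rV[R]_d -> R)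
    (f : 'rV[int]_d -> R) : \bar R :=
  ereal_inf [set ereal_sup ((EFin \o f) @` V) | V in norm_infty N].

Definition poly_growth (R : realType) (d : nat) (N : 'rV[R]_d -> R) (M : nat)
    (u : 'rV[int]_d -> R) : Prop :=
  (limsup_infty N (fun x => `|u x| / N (lattice_pt R x) ^+ M)%R < +oo)%E.

(* [mpoly.msize p] is one more than the total degree of [p], and [0] when
   [p = 0]. *)
Definition polynomial_deg_le (R : realType) (d M : nat)
    (u : 'rV[int]_d -> R) : Prop :=
  exists p : mpoly.mpoly d R, (mpoly.msize p <= M.+1)%N /\
    forall x, u x = mpoly.meval (fun i => lattice_pt R x 0 i) p.

(* [S] is the linear span of a finite family; in particular it is a linear
   subspace. *)
Definition finite_dimensional (R : realType) (T : Type) (S : set (T -> R)) :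
    Prop :=
  exists (n : nat) (e : 'I_n -> T -> R),
    S = [set u | exists c : 'I_n -> R, u = fun x => \sum_i c i * e i x].

(* Main.v *)
(* If u is harmonic, the mean over the neighbours of u^2 exceeds u^2 by at least
   (2d)^-1 (D_i u)^2, while (D_i u)^2 is itself subharmonic. Writing P for the
   averaging operator, this gives n (D_i u)^2 <= 2d P^n(u^2), and, iterating over
   a sequence s of k axes, (n / 2d)^k (D_s u)^2 <= P^(kn)(u^2) = O(n^(2M)); with
   k = 2M + 1 every difference of order 2M + 1 vanishes. If the differences of
   order k + 1 vanish, those of order k are constant, and taking them with step h
   multiplies them by h^k, although they are O(h^M); so k > M forces them to
   vanish too, and u has no differences of order M + 1. Newton interpolation makes
   such a u a polynomial of degree at most M, and u is determined by its
   differences of order at most M at any one point x0, which only involve the ball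
   of radius M around x0. *)
Require Import Defs.
From mathcomp Require Import all_boot all_order all_algebra.
From mathcomp Require Import zify ring lra.
From mathcomp Require Import (canonicals, coercions) mpoly.
From mathcomp Require Import boolp classical_sets functions reals ereal.
From mathcomp Require Import topology normedtype derive.

Set Implicit Arguments.
Unset Strict Implicit.
Unset Printing Implicit Defensive.

Import Order.TTheory GRing.Theory Num.Theory.
Import numFieldNormedType.Exports.
Local Open Scope classical_set_scope.
Local Open Scope ring_scope.

(** * Finite differences *)

Definition diff (V : zmodType) (R : pzRingType) (v : V) (u : V -> R) (x : V) :=
  u (x + v) - u x.

Definition diffs (V : zmodType) (R : pzRingType) (s : seq V) (u : V -> R) :=
  foldr (@diff V R) u s.

Lemma diffC (V : zmodType) (R : pzRingType) (v w : V) (u : V -> R) :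
  diff v (diff w u) = diff w (diff v u).
Proof.
by apply/funext => x; rewrite /diff (addrAC x) !opprD !opprK addrACA.
Qed.

Lemma diffs_diff (V : zmodType) (R : pzRingType) (s : seq V) (v : V)
    (u : V -> R) : diffs s (diff v u) = diff v (diffs s u).
Proof. by elim: s => //= w s ->; rewrite diffC. Qed.

Lemma diffs_diffs (V : zmodType) (R : pzRingType) (s t : seq V) (u : V -> R) :
  diffs s (diffs t u) = diffs t (diffs s u).
Proof. by elim: s => //= v s ->; rewrite diffs_diff. Qed.

Lemma diffs_perm (V : zmodType) (R : pzRingType) (s t : seq V) (u : V -> R) :
  perm_eq s t -> diffs s u = diffs t u.
Proof.
move: s t; apply: catCA_perm_subst => s1 s2 s3.
by rewrite /diffs !foldr_cat -/(diffs s3 u) -!/(diffs _ _) diffs_diffs.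
Qed.

Lemma diffs0 (V : zmodType) (R : pzRingType) (s : seq V) x :
  diffs s (fun=> 0 : R) x = 0.
Proof. by elim: s x => //= v s IH x; rewrite /diff !IH subrr. Qed.

Lemma diffs_linear (V : zmodType) (R : comPzRingType) (s : seq V) (a : R)
    (u v : V -> R) x :
  diffs s (fun x => a * u x + v x) x = a * diffs s u x + diffs s v x.
Proof. by elim: s x => //= w s IH x; rewrite /diff !IH; ring. Qed.

Lemma diffs_sum (V : zmodType) (R : comPzRingType) (I : Type) (r : seq I)
    (P : pred I) (s : seq V) (a : I -> R) (u : I -> V -> R) x :
  diffs s (fun x => \sum_(i <- r | P i) a i * u i x) x =
  \sum_(i <- r | P i) a i * diffs s (u i) x.
Proof.
elim: s x => //= w s IH x; rewrite /diff !IH -sumrB.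
by apply: eq_bigr => i _; rewrite mulrBr.
Qed.

Lemma diff_mulrn (V : zmodType) (R : pzRingType) (v : V) (u : V -> R) h c :
  (forall x, diff v u x = c) -> forall x, diff (v *+ h) u x = c *+ h.
Proof.
move=> dc x; elim: h => [|h IH]; first by rewrite /diff mulr0n addr0 subrr.
by rewrite [RHS]mulrS -IH -(dc (x + v *+ h)) /diff mulrSr !addrA subrK.
Qed.

(** Differences commute, so the steps are dilated one at a time; each dilation telescopes into [h]
    copies of a constant difference. *)
Lemma diffs_mulrn (V : zmodType) (R : comPzRingType) h (s : seq V)
    (u : V -> R) c :
  (forall x, diffs s u x = c) ->
  forall x, diffs [seq v *+ h | v <- s] u x = h%:R ^+ size s * c.
Proof.
elim: s u c => [|v s IH] u c dc x; first by rewrite /= mul1r; apply: dc.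
rewrite /= -diffs_diff (IH _ (c *+ h)) => [|y].
  by rewrite exprSr -mulrA mulr_natl.
by rewrite diffs_diff; apply: diff_mulrn.
Qed.

Lemma norm1D d (x y : 'rV[int]_d) : (norm1 (x + y) <= norm1 x + norm1 y)%N.
Proof.
rewrite !norm1E -big_split /=; apply: leq_sum => i _; rewrite mxE.
by move: (x _ _) (y _ _) => a b; lia.
Qed.

Lemma norm1N d (x : 'rV[int]_d) : norm1 (- x) = norm1 x.
Proof. by rewrite !norm1E; apply: eq_bigr => i _; rewrite mxE abszN. Qed.

Lemma norm10 d : norm1 (0 : 'rV[int]_d) = 0%N.
Proof. by rewrite norm1E big1 // => i _; rewrite mxE. Qed.

Lemma norm1_delta d (i : 'I_d) : norm1 (delta_mx 0 i : 'rV[int]_d) = 1%N.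
Proof.
rewrite norm1E (bigD1 i) //= big1 => [|j /negPf ji];
  by rewrite mxE eqxx ?ji ?eqxx.
Qed.

Lemma norm1_mulrn d (x : 'rV[int]_d) h : (norm1 (x *+ h) <= h * norm1 x)%N.
Proof.
elim: h => [|h IH]; first by rewrite mulr0n norm10.
by rewrite mulrS mulSn (leq_trans (norm1D _ _)) // leq_add2l.
Qed.

(** Unfolded, a difference of order k is a signed sum of 2^k values of [u], at [x] plus partial sums
    of the steps in [s]. *)
Lemma diffs_bound (R : realDomainType) d (s : seq 'rV[int]_d)
    (u : 'rV[int]_d -> R) x B :
  (forall y, (norm1 (y - x) <= \sum_(v <- s) norm1 v)%N -> `|u y| <= B) ->
  `|diffs s u x| <= 2 ^+ size s * B.
Proof.
elim: s x => [|v s IH] x uB /=.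
  by rewrite mul1r; apply: uB; rewrite subrr norm10.
rewrite exprS -mulrA mulrDl mul1r /diff (le_trans (ler_normB _ _)) //.
apply: lerD; apply: IH => y ly; apply: uB; rewrite big_cons.
  rewrite (_ : y - x = y - (x + v) + v); last by rewrite opprD addrA subrK.
  by rewrite (leq_trans (norm1D _ _)) // addnC leq_add2l.
by rewrite (leq_trans ly) // leq_addl.
Qed.

Definition axis_diffs (R : pzRingType) d (s : seq 'I_d) (u : 'rV[int]_d -> R) :=
  diffs [seq delta_mx 0 i | i <- s] u.

Lemma diff0_const (R : pzRingType) d (u : 'rV[int]_d -> R) :
  (forall i x, diff (delta_mx 0 i) u x = 0) -> forall x y, u x = u y.
Proof.
move=> du x y; have [n] := walk_connected x y.
elim: n x => [|n IH] x /=; first by move/eqP->.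
case/hasP => z /nbrsP[i zE] /IH <-.
case: zE => ->; apply/esym/eqP; rewrite -subr_eq0; last first.
  rewrite -opprB oppr_eq0 -[X in u X - _](subrK (delta_mx 0 i)).
  exact/eqP/du.
exact/eqP/du.
Qed.

(** Descent on the order: once all differences of order k + 1 vanish, those of order k are constant,
    hence zero because they are zero at [x0]. *)
Lemma axis_diffs_eq0 (R : pzRingType) d m (u : 'rV[int]_d -> R) x0 :
  (forall s x, size s = m -> axis_diffs s u x = 0) ->
  (forall s, (size s < m)%N -> axis_diffs s u x0 = 0) ->
  forall x, u x = 0.
Proof.
elim: m => [|m IH] du u0; first by move=> x; apply: (du [::] x).
apply: IH => [s x sm|s sm]; last by apply: u0; rewrite ltnW.
rewrite -(u0 s) ?sm //; apply: diff0_const => i y.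
by rewrite -(du (i :: s) y) //= sm.
Qed.

(** * Averaging and energy *)

Definition avg (R : realFieldType) d (f : 'rV[int]_d -> R)
    (x : 'rV[int]_d) : R :=
  ((2 * d)%:R)^-1 * \sum_(y <- nbrs x) f y.

Lemma size_nbrs d (x : 'rV[int]_d) : size (nbrs x) = (2 * d)%N.
Proof.
by rewrite size_cat !(size_map _ (enum _)) -cardE card_ord mul2n addnn.
Qed.

Lemma natr2_gt0 (R : realFieldType) d : (0 < d)%N -> 0 < ((2 * d)%:R : R).
Proof. by rewrite ltr0n muln_gt0. Qed.

Lemma avg_le (R : realFieldType) d (f g : 'rV[int]_d -> R) x :
  (forall y, f y <= g y) -> avg f x <= avg g x.
Proof. by move=> fg; rewrite ler_wpM2l ?invr_ge0 ?ler0n // ler_sum. Qed.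

Lemma iter_avg_le (R : realFieldType) d (f g : 'rV[int]_d -> R) n :
  (forall y, f y <= g y) ->
  forall x, iter n (@avg R d) f x <= iter n (@avg R d) g x.
Proof. by move=> fg; elim: n => //= n IH x; apply: avg_le. Qed.

Lemma avg_linear (R : realFieldType) d (a : R) (f g : 'rV[int]_d -> R) x :
  avg (fun y => a * f y + g y) x = a * avg f x + avg g x.
Proof. by rewrite /avg big_split /= -mulr_sumr; ring. Qed.

Lemma iter_avgZ (R : realFieldType) d (a : R) (f : 'rV[int]_d -> R) n x :
  iter n (@avg R d) (fun y => a * f y) x = a * iter n (@avg R d) f x.
Proof.
elim: n x => //= n IH x; rewrite /avg [RHS]mulrCA [in RHS]mulr_sumr.
congr (_ * _).
by apply: eq_bigr => y _.
Qed.

Lemma avg_cst (R : realFieldType) d (c : R) x :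
  (0 < d)%N -> avg (fun _ : 'rV[int]_d => c) x = c.
Proof.
move=> hd; rewrite /avg big_const_seq count_predT size_nbrs iter_addr addr0.
by rewrite -[c *+ _]mulr_natl mulKf // gt_eqF // natr2_gt0.
Qed.

(** Each averaging moves one step, so [n] of them at [x] only see the ball of radius [n]. *)
Lemma iter_avg_bound (R : realFieldType) d (f : 'rV[int]_d -> R) n x B :
  (0 < d)%N -> (forall y, (norm1 (y - x) <= n)%N -> f y <= B) ->
  iter n (@avg R d) f x <= B.
Proof.
move=> hd; elim: n x => [|n IH] x fB /=; first by rewrite fB // subrr norm10.
rewrite -[leRHS](avg_cst B x hd) ler_wpM2l ?invr_ge0 ?ler0n //.
rewrite !big_seq; apply: ler_sum => z /nbrsP[i zE].
apply: IH => y yz; apply: fB.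
rewrite -[y](subrK z) -addrA (leq_trans (norm1D _ _)) //.
rewrite -[leqRHS]addn1 leq_add //.
by case: zE => ->; rewrite addrAC subrr add0r ?norm1N norm1_delta.
Qed.

Lemma harmonicP (R : realType) d (u : 'rV[int]_d -> R) :
  (0 < d)%N -> harmonic u <-> forall x, avg u x = u x.
Proof.
move=> hd; have e x : laplacian u x = avg u x - u x.
  by rewrite -[X in _ - X](avg_cst (u x) x hd) /laplacian sumrB mulrBr.
split=> h x; last by rewrite e h subrr.
by apply/eqP; rewrite -subr_eq0 -e h.
Qed.

Lemma avg_diff (R : realFieldType) d v (u : 'rV[int]_d -> R) x :
  avg (diff v u) x = diff v (avg u) x.
Proof.
have E : nbrs (x + v) = [seq y + v | y <- nbrs x].
  by rewrite /nbrs map_cat -!map_comp; congr (_ ++ _);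
    apply: eq_map => i /=; rewrite addrAC.
by rewrite /diff /avg E big_map sumrB mulrBr.
Qed.

Lemma harmonic_diffs (R : realType) d s (u : 'rV[int]_d -> R) :
  (0 < d)%N -> harmonic u -> harmonic (diffs s u).
Proof.
move=> hd hu; elim: s => //= v s /(harmonicP _ hd) IH.
apply/harmonicP => // x; rewrite avg_diff; congr (diff _ _ _).
exact/funext.
Qed.

(** This is the variance identity: the mean of u^2 minus the square of the mean is the mean of (u y
    - u x)^2, of which only the neighbour [x + delta_mx 0 i] is kept. *)
Lemma energy (R : realType) d (u : 'rV[int]_d -> R) i x :
  (0 < d)%N -> harmonic u ->
  u x ^+ 2 + ((2 * d)%:R)^-1 * diff (delta_mx 0 i) u x ^+ 2 <=
    avg (fun y => u y ^+ 2) x.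
Proof.
move=> hd /(harmonicP _ hd) hu.
have E : avg (fun y => u y ^+ 2) x =
    u x ^+ 2 + avg (fun y => (u y - u x) ^+ 2) x.
  rewrite (_ : (fun y => (u y - u x) ^+ 2) =
    (fun y => (- 2 * u x) * u y + (u x ^+ 2 + 1 * u y ^+ 2))); last first.
    by apply/funext => y; ring.
  rewrite avg_linear hu.
  rewrite (_ : (fun y => u x ^+ 2 + 1 * u y ^+ 2) =
    (fun y => 1 * u y ^+ 2 + u x ^+ 2)); last by apply/funext => y; ring.
  by rewrite avg_linear avg_cst //; ring.
rewrite E lerD2l ler_wpM2l ?invr_ge0 ?ler0n //.
have xi : x + delta_mx 0 i \in nbrs x by apply/nbrsP; exists i; left.
rewrite (bigD1_seq _ xi (nbrs_uniq x)) /= lerDl.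
by apply: sumr_ge0 => y _; apply: sqr_ge0.
Qed.

(* Subharmonicity of g makes each of the n averagings gain at least c g. *)
Lemma iter_avg_energy (R : realFieldType) d (f g : 'rV[int]_d -> R) c :
  0 <= c -> (forall x, g x <= avg g x) ->
  (forall x, f x + c * g x <= avg f x) ->
  forall n x, f x + (n%:R * c) * g x <= iter n (@avg R d) f x.
Proof.
move=> c0 gP fP; elim=> [|n IH] x; first by rewrite mul0r mul0r addr0.
rewrite iterS (le_trans _ (avg_le x IH)) //.
rewrite (_ : (fun x => _) = (fun x => n%:R * c * g x + f x)); last first.
  by apply/funext => y; rewrite addrC.
rewrite avg_linear.
have : n%:R * c * g x <= n%:R * c * avg g x.
  by rewrite ler_wpM2l ?mulr_ge0 ?ler0n.
have := fP x; rewrite -[n.+1%:R]natr1; move: (n%:R) => N; lra.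
Qed.

(** Each axis in [s] consumes [n] averagings and gains a factor n / 2d: the induction hypothesis is
    averaged [n] more times, then [iter_avg_energy] adds one axis. *)
Lemma iter_avg_axis_diffs (R : realType) d (u : 'rV[int]_d -> R) n s x :
  (0 < d)%N -> harmonic u ->
  (n%:R / (2 * d)%:R) ^+ size s * axis_diffs s u x ^+ 2 <=
    iter (size s * n) (@avg R d) (fun y => u y ^+ 2) x.
Proof.
move=> hd hu; set c := (_ / _); have c0 : 0 <= c by rewrite divr_ge0 ?ler0n.
elim: s x => [|i s IH] x; first by rewrite mul1r.
rewrite -[size _]/(size s).+1 mulSn iterD.
apply: le_trans (iter_avg_le n IH x); rewrite iter_avgZ exprSr -mulrA.
apply: ler_wpM2l; first exact: exprn_ge0.
have hs : harmonic (axis_diffs s u) by apply: harmonic_diffs.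
apply: le_trans (_ :
  axis_diffs s u x ^+ 2 + c * axis_diffs (i :: s) u x ^+ 2 <= _).
  by rewrite lerDr sqr_ge0.
apply: (@iter_avg_energy _ _ (fun y => axis_diffs s u y ^+ 2)
  (fun y => axis_diffs (i :: s) u y ^+ 2)) => [|y|y].
- by rewrite invr_ge0 ler0n.
(* Subharmonicity of the squared difference is [energy] again, with its gradient term dropped. *)
- have hi : harmonic (axis_diffs (i :: s) u) by apply: harmonic_diffs.
  apply: le_trans (energy i y hd hi).
  by rewrite lerDl mulr_ge0 ?sqr_ge0 // invr_ge0.
- exact: energy.
Qed.

(** * Polynomial growth in the graph norm *)

(** If a > 0, dividing by the common power gives n + 1 <= B / a for every n, against the Archimedean
    property. *)
Lemma le0_of_growth (R : realType) (a B : R) m :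
  (forall n, n.+1%:R ^+ m.+1 * a <= B * n.+1%:R ^+ m) -> a <= 0.
Proof.
move=> h; rewrite leNgt; apply/negP => a0.
have := archi_boundP (normr_ge0 (B / a)); set n := Num.bound _.
rewrite ltNge => /negP; apply.
have := h n; rewrite exprS mulrAC ler_pM2r ?exprn_gt0 ?ltr0n // => naB.
apply: le_trans (ler_norm _); rewrite ler_pdivlMr //.
by apply: le_trans naB; rewrite ler_pM2r // ler_nat.
Qed.

(** The successor keeps the weight at least 1, so the bound can be global, origin included, rather
    than asymptotic. *)
Definition norm1_growth (R : realType) d M (u : 'rV[int]_d -> R) :=
  exists2 C : R, 0 <= C & forall x, `|u x| <= C * (norm1 x).+1%:R ^+ M.

Lemma norm1_growth_ball (R : realType) d M (u : 'rV[int]_d -> R) k x :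
  norm1_growth M u ->
  exists2 C : R, 0 <= C & forall n y, (norm1 (y - x) <= k * n.+1)%N ->
    `|u y| <= C * n.+1%:R ^+ M.
Proof.
(* The constant comes from norm1 y + 1 <= norm1 x + 1 + k (n + 1) <= (norm1 x + 1 + k) (n + 1). *)
move=> [C C0 uC]; exists (C * ((norm1 x).+1 + k)%:R ^+ M).
  by rewrite mulr_ge0 ?exprn_ge0 ?ler0n.
move=> n y yx; apply: le_trans (uC y) _; rewrite -mulrA -exprMn.
apply: ler_wpM2l => //; rewrite lerXn2r ?nnegrE ?ler0n ?mulr_ge0 ?ler0n //.
rewrite -natrM ler_nat mulnDl -{1}[y](subrK x).
rewrite (leq_ltn_trans (norm1D _ _)) // addnC -addSn leq_add //.
by rewrite leq_pmulr.
Qed.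

(** Dilating the steps by n + 1 multiplies the constant difference by (n + 1)^(size s), yet it
    remains a combination of values of [u] on a ball of radius proportional to n + 1, hence
    O(n^M). *)
Lemma axis_diffs_growth (R : realType) d M k (u : 'rV[int]_d -> R) s :
  norm1_growth M u -> (forall x y, axis_diffs s u x = axis_diffs s u y) ->
  size s = (M.+1 + k)%N -> forall x, axis_diffs s u x = 0.
Proof.
move=> gu cst sk x; apply/eqP; rewrite -normr_le0.
have [C C0 uC] := norm1_growth_ball (size s) x gu.
apply: (@le0_of_growth _ _ (2 ^+ size s * C) M) => n.
apply: le_trans (_ : n.+1%:R ^+ size s * `|axis_diffs s u x| <= _).
  rewrite ler_wpM2r // sk exprD ler_peMr ?exprn_ge0 ?ler0n //.
  by rewrite exprn_ege1 // ler1n.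
have /(_ n.+1 x) := diffs_mulrn _ (fun y => cst y x).
rewrite size_map => /(congr1 Num.norm).
rewrite normrM ger0_norm ?exprn_ge0 ?ler0n // => <-.
rewrite -mulrA -[in leRHS](size_map (fun i => delta_mx 0 i : 'rV[int]_d) s).
rewrite -[in leRHS](size_map (fun v : 'rV[int]_d => v *+ n.+1)).
apply: diffs_bound => y yx; apply: uC; apply: leq_trans yx _.
rewrite !big_map mulnC -sum1_size big_distrr /=; apply: leq_sum => i _.
by rewrite (leq_trans (norm1_mulrn _ _)) // norm1_delta.
Qed.

Lemma axis_diffs_harmonic_growth (R : realType) d M (u : 'rV[int]_d -> R) :
  (0 < d)%N -> harmonic u -> norm1_growth M u ->
  forall s x, size s = M.+1 -> axis_diffs s u x = 0.
Proof.
move=> hd hu gu.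
have step k : (forall s x, size s = (M.+1 + k.+1)%N -> axis_diffs s u x = 0) ->
    forall s x, size s = (M.+1 + k)%N -> axis_diffs s u x = 0.
  move=> du s x sk; apply: (axis_diffs_growth gu _ sk); apply: diff0_const => i y.
  by rewrite -(du (i :: s) y) //= sk addnS.
(* At order 2M + 1 the energy bound beats u^2 = O(n^(2M)) by exactly one power of n. *)
have base s x : size s = (M.+1 + M)%N -> axis_diffs s u x = 0.
  move=> sM; apply/eqP; rewrite -sqrf_eq0 eq_le sqr_ge0 andbT.
  have [C C0 uC] := norm1_growth_ball (size s) x gu.
  apply: (@le0_of_growth _ _ (C ^+ 2 * (2 * d)%:R ^+ size s) (M + M)) => n.
  have : iter (size s * n.+1) (@avg R d) (fun y => u y ^+ 2) x <=
      C ^+ 2 * n.+1%:R ^+ (M + M).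
    apply: iter_avg_bound => // y yx.
    rewrite addnn -mul2n mulnC exprM -exprMn -real_normK ?num_real //.
    by rewrite lerXn2r ?nnegrE ?uC // mulr_ge0 ?exprn_ge0.
  move/(le_trans (iter_avg_axis_diffs n.+1 s x hd hu)).
  rewrite expr_div_n -!mulrA mulrCA ler_pdivrMl ?exprn_gt0 ?natr2_gt0 //.
  rewrite {1}sM addSn => /le_trans; apply.
  by set D := _ ^+ size s; rewrite le_eqVlt; apply/orP; left; apply/eqP; ring.
(* The order falls from 2M + 1 to M + 1 as k runs up to M; beyond that, truncated subtraction leaves
   the claim unchanged. *)
have desc k : forall s x, size s = (M.+1 + (M - k))%N -> axis_diffs s u x = 0.
  elim: k => [|k IH]; first by rewrite subn0.
  case: (ltnP k M) => kM; first by apply: step; rewrite subnSK.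
  have /eqP Mk : (M - k == 0)%N by rewrite subn_eq0.
  have /eqP Mk1 : (M - k.+1 == 0)%N by rewrite subn_eq0 ltnW.
  by move: IH; rewrite Mk Mk1.
by move=> s x sM; apply: (desc M); rewrite subnn addn0.
Qed.

(** * Newton interpolation *)

(** The generalised binomial coefficient, written as a polynomial in [z] because lattice coordinates
    may be negative. *)
Definition rbinom (R : fieldType) (k : nat) (z : R) : R :=
  \prod_(j < k) ((z - j%:R) / j.+1%:R).

Lemma rbinomS (R : fieldType) k (z : R) :
  rbinom k.+1 z = rbinom k z * ((z - k%:R) / k.+1%:R).
Proof. exact: big_ord_recr. Qed.

Lemma rbinom_pascal (R : numFieldType) k (z : R) :
  rbinom k.+1 (z + 1) = rbinom k.+1 z + rbinom k z.
Proof.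
elim: k => [|k IH].
  by rewrite !rbinomS /rbinom !big_ord0 !mul1r !subr0 !divr1.
rewrite rbinomS IH (rbinomS k.+1 z) (rbinomS k z).
have k1 : k.+1%:R != 0 :> R by rewrite pnatr_eq0.
have k2 : k.+2%:R != 0 :> R by rewrite pnatr_eq0.
move: k1 k2; rewrite -[k.+2%:R]natr1 -[k.+1%:R]natr1 => k1 k2.
by field; rewrite k1 k2.
Qed.

(** A list of axes stands for the multi-index of its multiplicities; these are the Newton basis
    functions, discrete counterparts of x^a / a!. *)
Definition newton (R : realFieldType) d (s : seq 'I_d) (x : 'rV[int]_d) : R :=
  \prod_i rbinom (count_mem i s) (x 0 i)%:~R.

(** Only the factor of axis [i] changes, and Pascal's rule lowers its index by one; at multiplicity
    0 that factor is the constant 1. *)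
Lemma diff_newton (R : realFieldType) d i (s : seq 'I_d) x :
  diff (delta_mx 0 i) (newton R s) x =
  if i \in s then newton R (rem i s) x else 0.
Proof.
have E t : newton R t (x + delta_mx 0 i) =
    rbinom (count_mem i t) ((x 0 i)%:~R + 1) *
    \prod_(j | j != i) rbinom (count_mem j t) (x 0 j)%:~R.
  rewrite /newton (bigD1 i) //=; congr (_ * _).
    by rewrite !mxE !eqxx intrD.
  by apply: eq_bigr => j /negPf ji; rewrite !mxE eqxx ji addr0.
rewrite /diff E [X in _ - X](bigD1 i) //= -mulrBl; case: ifPn => si.
  have c j : count_mem j s = ((i == j) + count_mem j (rem i s))%N.
    by rewrite (permP (perm_to_rem si)).
  rewrite c eqxx add1n rbinom_pascal addrC addKr /newton [RHS](bigD1 i) //=.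
  congr (_ * _); apply: eq_bigr => j /negPf ji.
  by rewrite c eq_sym ji.
by rewrite (count_memPn si) /rbinom !big_ord0 subrr mul0r.
Qed.

(** Duality between differences and Newton functions of equal order: each difference strikes out one
    matching axis of [t], or gives zero. *)
Lemma axis_diffs_newton (R : realFieldType) d (s t : seq 'I_d) x :
  size s = size t -> axis_diffs s (newton R t) x = (perm_eq s t)%:R.
Proof.
elim: s t x => [|i s IH] t x st.
  move/esym/size0nil: st => ->.
  by rewrite /axis_diffs /= /newton big1 // => j _; rewrite /rbinom big_ord0.
rewrite /axis_diffs /= -diffs_diff; rewrite (funext (diff_newton R i t)).
case: (boolP (i \in t)) => ti.
  rewrite -/(axis_diffs s _) IH; last by rewrite size_rem // -st.
  by rewrite (permPr (perm_to_rem ti)) perm_cons.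
have -> : perm_eq (i :: s) t = false.
  by apply/negP => /perm_mem/(_ i); rewrite mem_head (negPf ti).
exact: diffs0.
Qed.

(** Bounding the size instead of the degree lets induction start from the zero function at [m = 0];
    at [M.+1] this is [polynomial_deg_le M] by unfolding. *)
Definition poly_size_le (R : realType) d m (u : 'rV[int]_d -> R) :=
  exists p : mpoly.mpoly d R, (mpoly.msize p <= m)%N /\
    forall x, u x = mpoly.meval (fun i => lattice_pt R x 0 i) p.

Lemma poly_size_le_leq (R : realType) d m n (u : 'rV[int]_d -> R) :
  (m <= n)%N -> poly_size_le m u -> poly_size_le n u.
Proof. by move=> mn [p [pm pu]]; exists p; split=> //; apply: leq_trans mn. Qed.

Lemma poly_size_leD (R : realType) d m (u v : 'rV[int]_d -> R) :
  poly_size_le m u -> poly_size_le m v -> poly_size_le m (fun x => u x + v x).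
Proof.
move=> [p [pm pu]] [q [qm qv]]; exists (p + q); split=> [|x].
  by rewrite (leq_trans (mpoly.msizeD_le _ _)) // geq_max pm.
by rewrite mpoly.mevalD -pu -qv.
Qed.

Lemma poly_size_leM (R : realType) d m n (u v : 'rV[int]_d -> R) :
  poly_size_le m.+1 u -> poly_size_le n.+1 v ->
  poly_size_le (m + n).+1 (fun x => u x * v x).
Proof.
move=> [p [pm pu]] [q [qn qv]]; exists (p * q); split=> [|x].
  have [->|p0] := eqVneq p 0; first by rewrite mul0r mpoly.msize0.
  have [->|q0] := eqVneq q 0; first by rewrite mulr0 mpoly.msize0.
  rewrite mpoly.msizeM // -subn1 leq_subLR add1n.
  by rewrite (leq_trans (leq_add pm qn)) // addSn addnS.
by rewrite mpoly.mevalM -pu -qv.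
Qed.

Lemma poly_size_leC (R : realType) d (c : R) :
  poly_size_le 1 (fun _ : 'rV[int]_d => c).
Proof.
exists (mpoly.mpolyC d c); split=> [|x]; last by rewrite mpoly.mevalC.
by rewrite mpoly.msizeC; case: eqP.
Qed.

Lemma poly_size_le_prod (R : realType) d (I : Type) (r : seq I) (k : I -> nat)
    (u : I -> 'rV[int]_d -> R) :
  (forall i, poly_size_le (k i).+1 (u i)) ->
  poly_size_le (\sum_(i <- r) k i).+1 (fun x => \prod_(i <- r) u i x).
Proof.
move=> h; elim: r => [|i r IH].
  rewrite big_nil (_ : (fun x => _) = fun=> 1); first exact: poly_size_leC.
  by apply/funext => x; rewrite big_nil.
rewrite big_cons (_ : (fun x => _) = fun x => u i x * \prod_(j <- r) u j x).
  exact: poly_size_leM.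
by apply/funext => x; rewrite big_cons.
Qed.

Lemma poly_size_le_sum (R : realType) d m (I : Type) (r : seq I)
    (u : I -> 'rV[int]_d -> R) :
  (forall i, poly_size_le m.+1 (u i)) ->
  poly_size_le m.+1 (fun x => \sum_(i <- r) u i x).
Proof.
move=> h; elim: r => [|i r IH].
  rewrite (_ : (fun x => _) = fun=> 0); last by apply/funext => x; rewrite big_nil.
  exact: poly_size_le_leq (poly_size_leC _ _).
rewrite (_ : (fun x => _) = fun x => u i x + \sum_(j <- r) u j x).
  exact: poly_size_leD.
by apply/funext => x; rewrite big_cons.
Qed.

Lemma poly_size_le_coord (R : realType) d (i : 'I_d) :
  poly_size_le 2 (fun x : 'rV[int]_d => (x 0 i)%:~R : R).
Proof.
exists (mpoly.mpolyX R (mpoly.mnm1 i)); split=> [|x].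
  by rewrite mpoly.msizeX mpoly.mdeg1.
by rewrite mpoly.mevalXU mxE.
Qed.

Lemma poly_size_le_newton (R : realType) d (s : seq 'I_d) :
  poly_size_le (size s).+1 (newton R s).
Proof.
have -> : size s = (\sum_i count_mem i s)%N.
  elim: s => [|j s IH]; first by rewrite big1.
  rewrite (eq_bigr (fun i => (j == i) + count_mem i s)%N) // big_split /= -IH.
  rewrite (bigD1 j) //= eqxx big1 // => i /negPf.
  by rewrite eq_sym => ->.
apply: poly_size_le_prod => i.
rewrite -[X in X.+1](card_ord (count_mem i s)) -sum1_card.
apply: poly_size_le_prod => j.
apply: (@poly_size_leM _ _ 1 0); last exact: poly_size_leC.
apply: poly_size_leD; first exact: poly_size_le_coord.
exact: poly_size_le_leq (poly_size_leC _ _).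
Qed.

(** To pass from m to m + 1, a Newton combination [q] of degree at most m with the same differences
    of order m as [u] is subtracted; the remainder has none of order m. *)
Lemma poly_of_axis_diffs (R : realType) d m (u : 'rV[int]_d -> R) :
  (forall s x, size s = m -> axis_diffs s u x = 0) -> poly_size_le m u.
Proof.
elim: m u => [|m IH] u du.
  exists 0; split=> [|x]; first by rewrite mpoly.msize0.
  by rewrite mpoly.meval0; apply: (du [::]).
(* Permuting t does not change [newton R t], so each coefficient is shared among
   the [cls t] tuples of its class. *)
pose cls (t : m.-tuple 'I_d) := #|[pred t' : m.-tuple 'I_d | perm_eq t t']|.
pose a (t : m.-tuple 'I_d) : R := axis_diffs t u 0 / (cls t)%:R.
pose q x := \sum_(t : m.-tuple 'I_d) a t * newton R t x.
have dq s x : size s = m -> axis_diffs s q x = axis_diffs s u x.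
  move=> sm; pose s' := Tuple (introT eqP sm).
  have -> : axis_diffs s u x = axis_diffs s u 0.
    by apply: diff0_const => i y; rewrite -(du (i :: s) y) //= sm.
  rewrite [LHS]diffs_sum.
  (* By duality only the tuples permuting [s] contribute, all equally, and there are [cls s'] of
     them. *)
  rewrite (eq_bigr (fun t : m.-tuple 'I_d =>
    if perm_eq s t then axis_diffs s u 0 / (cls s')%:R else 0)) => [|t _].
    rewrite -big_mkcond sumr_const -[RHS](divfK (_ : (cls s')%:R != 0)).
      by rewrite mulr_natr.
    rewrite pnatr_eq0 -lt0n; apply/card_gt0P; exists s'; exact: perm_refl.
  rewrite -/(axis_diffs s _) axis_diffs_newton ?size_tuple //.
  case: ifP => [st|_]; rewrite ?mulr0 // mulr1 /a.
  congr (_ / _%:R).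
    by rewrite /axis_diffs (diffs_perm _ (perm_map _ st)).
  by apply: eq_card => t'; rewrite !inE (permPl st).
have -> : u = fun x => (u x + -1 * q x) + q x.
  by apply/funext => x; ring.
apply: poly_size_leD.
  apply: poly_size_le_leq (leqnSn m) _.
  rewrite (_ : (fun x => _) = (fun x => -1 * q x + u x)); last first.
    by apply/funext => x; rewrite addrC.
  apply: IH => s x sm; rewrite /axis_diffs diffs_linear.
  by rewrite -!/(axis_diffs s _) dq // mulN1r addNr.
apply: poly_size_le_sum => t.
apply: (@poly_size_leM _ _ 0 m); first exact: poly_size_leC.
rewrite -[X in poly_size_le X.+1](size_tuple t).
exact: poly_size_le_newton.
Qed.

(** * Finite dimension *)

(** Induction on [l]: the first functional either vanishes on [S], or [S] is its kernel in [S] plus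
    the line through some [u0] outside it. With no functional left, [S] is zero. *)
Lemma finite_dimensional_separated (R : realType) (T : Type) (I : eqType)
    (l : seq I) (L : I -> (T -> R) -> R) (S : set (T -> R)) :
  (forall i a u v, L i (fun x => a * u x + v x) = a * L i u + L i v) ->
  S (fun=> 0) ->
  (forall a u v, S u -> S v -> S (fun x => a * u x + v x)) ->
  (forall u, S u -> {in l, forall i, L i u = 0} -> u = fun=> 0) ->
  finite_dimensional S.
Proof.
move=> linL; elim: l S => [|i l IH] S S0 linS sepS.
  exists 0%N, (fun _ _ => 0); apply/seteqP; split=> u.
    by move=> /sepS ->//; exists (fun=> 0); apply/funext => x; rewrite big_ord0.
  case=> c ->; rewrite (_ : (fun x => _) = fun=> 0) //.
  by apply/funext => x; rewrite big_ord0.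
have Li0 : L i (fun=> 0) = 0.
  rewrite -[RHS](addNr (L i (fun=> 0))) -[X in _ = X + _]mulN1r -linL.
  by congr (L i _); apply/funext => x; rewrite mulr0 addr0.
pose S' := [set u | S u /\ L i u = 0].
have [n [e S'E]] : finite_dimensional S'.
  apply: IH => [|a u v [Su Lu] [Sv Lv]|u [Su Lu] lu]; first by split.
    by split; [exact: linS | rewrite linL Lu Lv mulr0 addr0].
  by apply: sepS => // j; rewrite inE => /predU1P[->|/lu].
have [[u0 [Su0 Lu0]]|noS] := pselect (exists u, S u /\ L i u != 0); last first.
  exists n, e; rewrite -S'E; apply/seteqP; split=> u; last by case.
  by move=> Su; split=> //; apply: contrapT => /eqP Lu; apply: noS; exists u.
exists n.+1, (fun j => oapp e u0 (unlift ord0 j)); apply/seteqP; split=> u.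
  move=> Su; pose k := L i u / L i u0.
  have : S' (fun x => - k * u0 x + u x).
    split; first exact: linS.
    by rewrite linL mulNr divfK // addNr.
  rewrite S'E => -[c cE].
  exists (fun j => oapp c k (unlift ord0 j)); apply/funext => x.
  rewrite big_ord_recl unlift_none /=.
  under eq_bigr do rewrite liftK /=.
  by rewrite -(congr1 (fun f => f x) cE) /=; ring.
case=> c ->.
rewrite (_ : (fun x => _) =
  (fun x => c ord0 * u0 x + \sum_j c (lift ord0 j) * e j x)); last first.
  apply/funext => x; rewrite big_ord_recl unlift_none /=.
  by under eq_bigr do rewrite liftK /=.
apply: linS => //.
have : S' (fun x => \sum_j c (lift ord0 j) * e j x).
  by rewrite S'E; exists (fun j => c (lift ord0 j)).
by case.
Qed.

(** * Growth with respect to a norm *)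

Lemma is_norm0 (R : realType) d (N : 'rV[R]_d -> R) : is_norm N -> N 0 = 0.
Proof. by case=> _ hom _; rewrite -[X in N X](scale0r 0) hom normr0 mul0r. Qed.

(** Nonnegativity is not among the axioms; it follows from 0 = N (x - x) <= 2 N x. *)
Lemma is_norm_ge0 (R : realType) d (N : 'rV[R]_d -> R) x : is_norm N -> 0 <= N x.
Proof.
move=> hN; have [tri hom _] := hN.
have := tri x (-1 *: x); rewrite hom normrN1 mul1r scaleN1r subrr is_norm0 //.
lra.
Qed.

Lemma is_norm_upper (R : realType) d (N : 'rV[R]_d -> R) :
  is_norm N ->
  exists2 K, 0 <= K & forall x, N x <= K * \sum_i `|x 0 i|.
Proof.
move=> hN; have [tri hom _] := hN.
exists (\sum_i N (delta_mx 0 i)) => [|x].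
  by apply: sumr_ge0 => i _; apply: is_norm_ge0.
have triS (r : seq 'I_d) (F : 'I_d -> 'rV[R]_d) :
    N (\sum_(i <- r) F i) <= \sum_(i <- r) N (F i).
  elim: r => [|i r IH]; first by rewrite !big_nil is_norm0.
  by rewrite !big_cons (le_trans (tri _ _)) // lerD2l.
rewrite {1}[x]row_sum_delta (le_trans (triS _ _)) // mulr_sumr.
apply: ler_sum => i _; rewrite hom mulrC ler_wpM2r //.
rewrite (bigD1 i) //= lerDl; apply: sumr_ge0 => j _; exact: is_norm_ge0.
Qed.

(** [N] is Lipschitz for the sup norm, so it attains a minimum on the compact unit sphere; this is
    positive by definiteness and serves as c by homogeneity. *)
Lemma is_norm_lower (R : realType) d (N : 'rV[R]_d -> R) :
  is_norm N -> exists2 c, 0 < c & forall (x : 'rV[R]_d) i, c * `|x 0 i| <= N x.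
Proof.
move=> hN; have [tri hom def] := hN.
have [K K0 NK] := is_norm_upper hN.
have coord (x : 'rV[R]_d) i : `|x 0 i| <= `|x|.
  rewrite [leRHS]/Num.Def.normr /= mx_normrE.
  by apply/bigmax_geP; right => /=; exists (0, i).
have lip x y : `|N x - N y| <= K * d%:R * `|x - y|.
  have NB (z w : 'rV[R]_d) : N z - N w <= N (z - w).
    by rewrite lerBlDr -{1}[z](subrK w) tri.
  have NN (z w : 'rV[R]_d) : N (z - w) = N (w - z).
    by rewrite -opprB -scaleN1r hom normrN1 mul1r.
  apply: le_trans (_ : N (x - y) <= _).
    by rewrite ler_norml lerNl opprB NB NN NB.
  rewrite (le_trans (NK _)) // -mulrA ler_wpM2l //.
  rewrite -[d in d%:R]card_ord mulr_natl -sumr_const ler_sum //.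
have cN : continuous N.
  move=> x; apply/(cvgrPdist_lt (FF := nbhs_filter x)) => e e0.
  have KD : 0 < K * d%:R + 1 by rewrite ltr_wpDl // mulr_ge0.
  near=> y.
  rewrite (le_lt_trans (lip _ _)) //.
  apply: le_lt_trans (_ : (K * d%:R + 1) * `|x - y| < _).
    by rewrite ler_wpM2r // lerDl.
  rewrite -ltr_pdivlMl //; near: y.
  by apply: cvgr_dist_lt; rewrite // mulr_gt0 ?invr_gt0.
pose S := [set x : 'rV[R]_d | `|x| = 1].
have cS : compact S.
  apply: bounded_closed_compact.
    exists 1; split; first exact: num_real.
    by move=> M M1 x /= ->; rewrite ltW.
  apply: (@closed_comp _ _ (fun x : 'rV[R]_d => `|x|) [set 1]); last first.
    exact: closed_eq.
  by move=> x _; apply: norm_continuous.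
(* An empty sphere forces every vector to be zero, and then any c > 0 will do. *)
have [[x0 Sx0]|S0] := pselect (S !=set0); last first.
  exists 1 => // x i; suff -> : x = 0 by rewrite mxE normr0 mulr0 is_norm0.
  apply: contrapT => /eqP x0; apply: S0; exists (`|x|^-1 *: x).
  by rewrite /S /= normrZ normfV normr_id mulVf // normr_eq0.
have [||c Sc cmin] := @EVT_min_rV _ _ N S _ cS.
- by exists x0.
- exact: continuous_subspaceT.
have {}Sc : `|c| = 1 by rewrite inE in Sc.
have Nc : 0 < N c.
  rewrite lt_neqAle is_norm_ge0 // andbT eq_sym; apply/eqP => /def c0.
  by move: Sc; rewrite c0 normr0 => /esym/eqP; rewrite oner_eq0.
exists (N c) => // x i.
have [->|x_neq0] := eqVneq x 0; first by rewrite mxE normr0 mulr0 is_norm0.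
have nx : 0 < `|x| by rewrite normr_gt0.
apply: le_trans (_ : N c * `|x| <= _); first by rewrite ler_wpM2l // ltW.
rewrite -ler_pdivlMr // mulrC -[X in X * _]ger0_norm ?invr_ge0 // -hom.
by apply: cmin; rewrite inE /S /= normrZ normfV normr_id mulVf // gt_eqF.
Unshelve. all: by end_near.
Qed.

(** The limsup is an infimum of suprema over the sets N > r, so it is below +oo exactly when one of
    these suprema is. *)
Lemma poly_growthP (R : realType) d (N : 'rV[R]_d -> R) M (u : 'rV[int]_d -> R) :
  poly_growth N M u <->
  exists r C, forall x, r < N (lattice_pt R x) ->
    `|u x| / N (lattice_pt R x) ^+ M <= C.
Proof.
split=> [/ereal_inf_lt[_ [V [r _ rV] <-]]|[r [C uC]]].
  set f := (X in X @` V); set s := ereal_sup _ => s_lt.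
  exists r, (fine s) => x /rV Vx.
  (* The finite value at [x] excludes a supremum of -oo, so [fine s] is the true supremum. *)
  have : (f x <= s)%E by apply: ereal_sup_ubound; exists x.
  by case: s s_lt => [s| |] //= _; rewrite ?lee_fin.
apply: (@le_lt_trans _ _ C%:E); last exact: ltry.
pose V := [set x : 'rV[int]_d | r < N (lattice_pt R x)].
apply: ereal_inf_le; exists (ereal_sup ((EFin \o
  (fun x => `|u x| / N (lattice_pt R x) ^+ M)) @` V)).
  by exists V => //; exists r.
by apply: ge_ereal_sup => _ [x Vx <-]; rewrite lee_fin uC.
Qed.

Lemma poly_growth_linear (R : realType) d (N : 'rV[R]_d -> R) M a
    (u v : 'rV[int]_d -> R) :
  is_norm N -> poly_growth N M u -> poly_growth N M v ->
  poly_growth N M (fun x => a * u x + v x).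
Proof.
move=> hN /poly_growthP[r1 [C1 h1]] /poly_growthP[r2 [C2 h2]].
apply/poly_growthP; exists (Num.max r1 r2), (`|a| * C1 + C2) => x.
rewrite gt_max => /andP[/h1 u1 /h2 v2].
apply: le_trans (_ : `|a| * (`|u x| / N (lattice_pt R x) ^+ M) +
  `|v x| / N (lattice_pt R x) ^+ M <= _); last by rewrite lerD // ler_wpM2l.
rewrite mulrA -mulrDl ler_wpM2r ?invr_ge0 ?exprn_ge0 ?is_norm_ge0 //.
by rewrite -normrM ler_normD.
Qed.

Lemma poly_growth0 (R : realType) d (N : 'rV[R]_d -> R) M :
  poly_growth N M (fun=> 0).
Proof. by apply/poly_growthP; exists 0, 0 => x _; rewrite normr0 mul0r. Qed.

Lemma harmonic_linear (R : realType) d a (u v : 'rV[int]_d -> R) :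
  (0 < d)%N -> harmonic u -> harmonic v -> harmonic (fun x => a * u x + v x).
Proof.
move=> hd /(harmonicP _ hd) hu /(harmonicP _ hd) hv.
by apply/harmonicP => // x; rewrite avg_linear hu hv.
Qed.

Lemma harmonic0 (R : realType) d :
  (0 < d)%N -> harmonic (fun _ : 'rV[int]_d => 0 : R).
Proof. by move=> hd; apply/harmonicP => // x; rewrite avg_cst. Qed.

Lemma norm1_walk d (x : 'rV[int]_d) : walk (norm1 x) 0 x.
Proof. by rewrite /norm1 /graph_dist; case: ex_minnP. Qed.

(** Iterating the neighbour sum k times on |u| adds up |u| over the ends of all k-step walks, which
    dominates |u| at every point so reached. *)
Lemma norm1_ball_bounded (R : realType) d (u : 'rV[int]_d -> R) n :
  exists2 B, 0 <= B & forall x, (norm1 x <= n)%N -> `|u x| <= B.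
Proof.
pose T (f : 'rV[int]_d -> R) x := \sum_(y <- nbrs x) f y.
have T0 k x : 0 <= iter k T (fun y => `|u y|) x.
  by elim: k x => //= k IH x; apply: sumr_ge0.
have walkT k x y : walk k x y -> `|u y| <= iter k T (fun y => `|u y|) x.
  elim: k x => [|k IH] x /=; first by move/eqP->.
  case/hasP=> z zx /IH /le_trans; apply.
  rewrite /T (bigD1_seq _ zx (nbrs_uniq x)) /= lerDl.
  by apply: sumr_ge0.
exists (\sum_(k < n.+1) iter k T (fun y => `|u y|) 0).
  exact: sumr_ge0.
move=> x; rewrite -ltnS => xn; rewrite (le_trans (walkT _ _ _ (norm1_walk x))) //.
rewrite (bigD1 (Ordinal xn)) //= lerDl.
exact: sumr_ge0.
Qed.

Lemma norm1_intr (R : realType) d (x : 'rV[int]_d) :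
  (norm1 x)%:R = \sum_i `|lattice_pt R x 0 i|.
Proof.
rewrite norm1E natr_sum; apply: eq_bigr => i _.
by rewrite mxE -intr_norm natr_absz.
Qed.

(** Where [N] is large, the growth bound combines with N <= K norm1; the remaining points lie in a
    graph ball, on which [u] is bounded. *)
Lemma norm1_growth_poly (R : realType) d (N : 'rV[R]_d -> R) M
    (u : 'rV[int]_d -> R) :
  is_norm N -> poly_growth N M u -> norm1_growth M u.
Proof.
move=> hN /poly_growthP[r [C uC]].
have [K K0 NK] := is_norm_upper hN.
have [c c0 Nc] := is_norm_lower hN.
(* A nonnegative threshold makes [N] positive beyond it, so that the quotient can be cleared. *)
pose r' := Num.max r 0.
(* Where N <= r', every coordinate is at most r' / c in absolute value. *)
pose n := Num.bound (\sum_(i < d) r' / c).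
have [B B0 uB] := norm1_ball_bounded u n.
exists (`|C| * K ^+ M + B); first by rewrite addr_ge0 ?mulr_ge0 ?exprn_ge0.
move=> x; rewrite mulrDl -mulrA -exprMn.
have P1 : 1 <= (norm1 x).+1%:R ^+ M :> R by rewrite exprn_ege1 // ler1n.
have [Nx|Nx] := ltP r' (N (lattice_pt R x)).
  move: Nx; rewrite gt_max => /andP[/uC Cx N0].
  move: Cx; rewrite ler_pdivrMr ?exprn_gt0 // => /le_trans; apply.
  rewrite ler_wpDr ?mulr_ge0 ?exprn_ge0 //.
  apply: le_trans (_ : `|C| * N (lattice_pt R x) ^+ M <= _).
    by rewrite ler_wpM2r ?ler_norm ?exprn_ge0 // ltW.
  rewrite ler_wpM2l // lerXn2r ?nnegrE ?mulr_ge0 ?(ltW N0) //.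
  by rewrite (le_trans (NK _)) // -norm1_intr ler_wpM2l // ler_nat.
have xn : (norm1 x <= n)%N.
  rewrite -(ler_nat R) norm1_intr ltW //.
  apply: le_lt_trans (archi_boundP _); last first.
    by apply: sumr_ge0 => i _; rewrite divr_ge0 ?le_max ?lexx ?orbT // ltW.
  by apply: ler_sum => i _; rewrite ler_pdivlMr // mulrC (le_trans (Nc _ _)).
rewrite (le_trans (uB x xn)) // ler_wpDl ?ler_peMr //.
by rewrite mulr_ge0 // exprn_ge0 // mulr_ge0.
Qed.

Theorem corollary1p9 (R : realType) (d : nat) (hd : (0 < d)%N)
    (N : 'rV[R]_d -> R) (hN : is_norm N) (M : nat) :
  (forall u : 'rV[int]_d -> R,
      harmonic u -> (exists x, u x != 0) -> poly_growth N M u ->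
      polynomial_deg_le M u)
  /\ finite_dimensional
       [set u : 'rV[int]_d -> R | harmonic u /\ poly_growth N M u]
  /\ (forall u : 'rV[int]_d -> R,
      harmonic u -> (exists x, u x != 0) -> poly_growth N M u ->
      forall x0 : 'rV[int]_d,
        ~ (forall x : 'rV[int]_d, (norm1 (x - x0) <= M)%N -> u x = 0)).
Proof.
have vanish u : harmonic u -> poly_growth N M u ->
    forall s x, size s = M.+1 -> axis_diffs s u x = 0.
  move=> hu /(norm1_growth_poly hN); exact: axis_diffs_harmonic_growth.
split=> [u hu _ gu|]; first exact: poly_of_axis_diffs (vanish u hu gu).
split=> [|u hu [x ux] gu x0 u0].
  (* The separating functionals are the differences of order at most M at 0, indexed by the finite
     type of axis lists of length at most M. *)
  apply: (@finite_dimensional_separated _ _ _ (enum {: M.-bseq 'I_d})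
    (fun s u => axis_diffs s u 0)) => [s a u v||a u v [hu gu] [hv gv]|].
  - exact: diffs_linear.
  - by split; [exact: harmonic0 | exact: poly_growth0].
  - by split; [exact: harmonic_linear | exact: poly_growth_linear].
  - move=> u [hu gu] u0; apply/funext.
    apply: (axis_diffs_eq0 (x0 := 0) (vanish u hu gu)) => s sM.
    exact: (u0 (Bseq sM)) (mem_enum _ _).
move/negP: ux; apply; apply/eqP.
apply: (axis_diffs_eq0 (x0 := x0) (vanish u hu gu)) => s sM.
(* [diffs_bound] is applied with bound 0: a difference of order at most M at [x0] only sees the ball
   where [u] vanishes. *)
apply/eqP; rewrite -normr_le0 -[leRHS](mulr0 (2 ^+ size s)).
rewrite -[in leRHS](size_map (fun i => delta_mx 0 i : 'rV[int]_d) s).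
apply: diffs_bound => y yx; rewrite u0 ?normr0 // (leq_trans yx) //.
rewrite big_map (eq_bigr (fun=> 1%N)) => [|i _]; last exact: norm1_delta.
by rewrite sum1_size.
Qed.
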